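(* Let $\mathbb K$ be an algebraically closed field of characteristic zero, let $f(X)=X^r+a_{r-1}X^{r-1}+\dots+a_0\in\mathbb K[X]$ with $r>1$, and let $\varphi(X,Z)=Z^d+b_{d-1}(X)Z^{d-1}+\dots+b_1(X)Z+b_0(X)\in\mathbb K[X][Z]$ with $d>1$. Let $\mathcal B=\mathbb K[X,Y,Z]/(f(X)Y-\varphi(X,Z))=\mathbb K[x,y,z]$, where $x,y,z$ are the images of $X,Y,Z$. If $\mathcal D$ is the ($\mathbb K$-linear) derivation of $\mathcal B$ given by $\mathcal D(x)=0$, $\mathcal D(y)=\varphi_z(x,z)$ and $\mathcal D(z)=f(x)$, then $$\operatorname{LND}(\mathcal B)=\{h\mathcal D\mid h\in\mathbb K[x]\setminus\{0\}\}.$$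
   Context: For a commutative ring $A$ with unity of characteristic zero, a derivation $D:A\to A$ is locally nilpotent if for each $a\in A$ there is $n\in\mathbb N$ with $D^n(a)=0$. $\operatorname{LND}(A)$ denotes the set of all nonzero locally nilpotent derivations of $A$. Here $\varphi_z(x,z)$ denotes the partial derivative $\frac{\partial\varphi}{\partial Z}$ evaluated at $(X,Z)=(x,z)$. The derivation $\mathcal D$ is the one induced on $\mathcal B$ by the derivation of $\mathbb K[X,Y,Z]$ sending $X\mapsto 0$, $Y\mapsto \frac{\partial\varphi}{\partial Z}(X,Z)$, $Z\mapsto f(X)$, which kills $f(X)Y-\varphi(X,Z)$. *)

(* Defs.v *)
(* MathComp; boolp (classical logic) only serves to turn membership in an ideal
   into a boolean. *)
From HB Require Import structures.
From mathcomp Require Import all_boot all_algebra.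
From mathcomp Require Import boolp.
From mathcomp Require Import mpoly.

Set Implicit Arguments.
Unset Strict Implicit.
Unset Printing Implicit Defensive.

Import GRing.Theory.
Import Quotient.
Local Open Scope ring_scope.
Local Open Scope quotient_scope.

(* ring_quotient.v puts a ring structure only on quotients by proper ideals,
   whereas the quotient below is defined for every p; hence the present
   (possibly zero) ring structure on its additive quotient {quot I}. *)
Section PrincipalQuotient.

Variables (K : comNzRingType) (R : comAlgType K) (p : R).

Definition principal_ideal : {pred R} := fun u => `[< exists q : R, u = q * p >].

Lemma principal_idealP u :
  reflect (exists q : R, u = q * p) (u \in principal_ideal).
Proof. exact: asboolP. Qed.

Lemma principal_ideal_zmod_closed : zmod_closed principal_ideal.
Proof.
split; first by apply/principal_idealP; exists 0; rewrite mul0r.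
move=> u v /principal_idealP[a ->] /principal_idealP[b ->].
by apply/principal_idealP; exists (a - b); rewrite mulrBl.
Qed.

HB.instance Definition _ :=
  GRing.isZmodClosed.Build R principal_ideal principal_ideal_zmod_closed.

Lemma principal_idealMr a u : u \in principal_ideal -> a * u \in principal_ideal.
Proof.
move=> /principal_idealP[b ->]; apply/principal_idealP.
by exists (a * b); rewrite mulrA.
Qed.

Definition principal_quot : Type := quot (principal_ideal : zmodClosed R).

HB.instance Definition _ := Choice.on principal_quot.
HB.instance Definition _ := GRing.Zmodule.on principal_quot.
HB.instance Definition _ := ZmodQuotient.on principal_quot.

Local Notation Q := principal_quot.
Implicit Types x y z : Q.

Definition pq_proj : R -> Q := \pi_Q.

Definition pq_one : Q := pq_proj 1.
Definition pq_mul x y : Q := pq_proj (repr x * repr y).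
Definition pq_scale (c : K) x : Q := pq_proj (c *: repr x).

Lemma pq_projK x : pq_proj (repr x) = x.
Proof. exact: reprK. Qed.

Lemma pq_projE (a b : R) :
  pq_proj a = pq_proj b <-> exists q : R, a - b = q * p.
Proof.
split=> [/eqP | abI].
  by rewrite -(@idealrBE _ (principal_ideal : zmodClosed R)) => /principal_idealP.
apply/eqP; rewrite -(@idealrBE _ (principal_ideal : zmodClosed R)).
exact/principal_idealP.
Qed.

Lemma pq_projD : {morph pq_proj : a b / a + b}.
Proof. exact: raddfD. Qed.

Lemma pq_projM a b : pq_proj (a * b) = pq_mul (pq_proj a) (pq_proj b).
Proof.
have repI c : exists q, c - repr (pq_proj c) = q * p.
  by apply/pq_projE; rewrite pq_projK.
have [[u hu] [v hv]] := (repI a, repI b).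
apply/pq_projE; exists (a * v + u * repr (pq_proj b)).
by rewrite mulrDl -mulrA -hv mulrAC -hu mulrBr mulrBl addrA subrK.
Qed.

Lemma pq_projZ c a : pq_proj (c *: a) = pq_scale c (pq_proj a).
Proof.
have [u hu] : exists q, a - repr (pq_proj a) = q * p.
  by apply/pq_projE; rewrite pq_projK.
by apply/pq_projE; exists (c *: u); rewrite -scalerBr hu scalerAl.
Qed.

Lemma pq_ind (P : Q -> Prop) : (forall a, P (pq_proj a)) -> forall x, P x.
Proof. by move=> h x; rewrite -(pq_projK x). Qed.

Fact pq_mulA : associative pq_mul.
Proof.
elim/pq_ind=> a; elim/pq_ind=> b; elim/pq_ind=> c.
by rewrite -!pq_projM mulrA.
Qed.

Fact pq_mulC : commutative pq_mul.
Proof. by elim/pq_ind=> a; elim/pq_ind=> b; rewrite -!pq_projM mulrC. Qed.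

Fact pq_mul1 : left_id pq_one pq_mul.
Proof. by elim/pq_ind=> a; rewrite -pq_projM mul1r. Qed.

Fact pq_mulDl : left_distributive pq_mul +%R.
Proof.
elim/pq_ind=> a; elim/pq_ind=> b; elim/pq_ind=> c.
by rewrite -pq_projD -!pq_projM mulrDl pq_projD.
Qed.

HB.instance Definition _ :=
  GRing.Zmodule_isComPzRing.Build Q pq_mulA pq_mulC pq_mul1 pq_mulDl.

Fact pq_scaleA c d x : pq_scale c (pq_scale d x) = pq_scale (c * d) x.
Proof. by elim/pq_ind: x => a; rewrite -!pq_projZ scalerA. Qed.

Fact pq_scale1 : left_id 1 pq_scale.
Proof. by elim/pq_ind=> a; rewrite -pq_projZ scale1r. Qed.

Fact pq_scaleDr : right_distributive pq_scale +%R.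
Proof.
move=> c; elim/pq_ind=> a; elim/pq_ind=> b.
by rewrite -pq_projD -!pq_projZ scalerDr pq_projD.
Qed.

Fact pq_scaleDl x : {morph pq_scale^~ x : c d / c + d}.
Proof.
by elim/pq_ind: x => a c d; rewrite -!pq_projZ scalerDl pq_projD.
Qed.

HB.instance Definition _ := GRing.Zmodule_isLmodule.Build K Q
  pq_scaleA pq_scale1 pq_scaleDr pq_scaleDl.

Fact pq_proj_is_linear : linear pq_proj.
Proof. by move=> c a b; rewrite pq_projD pq_projZ. Qed.

Fact pq_proj_is_monoid_morphism : monoid_morphism pq_proj.
Proof. by split=> // a b; rewrite pq_projM. Qed.

HB.instance Definition _ := GRing.isLinear.Build K R Q _ pq_proj pq_proj_is_linear.
HB.instance Definition _ :=
  GRing.isMonoidMorphism.Build R Q pq_proj pq_proj_is_monoid_morphism.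

End PrincipalQuotient.

Section Derivations.

Variable A : comPzRingType.
Implicit Type D : A -> A.

Definition derivation D : Prop :=
  (forall a b, D (a + b) = D a + D b) /\
  (forall a b, D (a * b) = D a * b + a * D b).

Definition locally_nilpotent D : Prop :=
  forall a, exists n : nat, iter n D a = 0.

Definition LND D : Prop :=
  [/\ derivation D, (exists a, D a <> 0) & locally_nilpotent D].

End Derivations.

Section Surface.

Variable K : fieldType.

Local Notation KXYZ := {mpoly K[3]}.

Definition varX : KXYZ := 'X_(inord 0).
Definition varY : KXYZ := 'X_(inord 1).
Definition varZ : KXYZ := 'X_(inord 2).

(* p(X) and q(X, Z) as elements of K[X, Y, Z]; K[X][Z] is {poly {poly K}}, the
   outer indeterminate being Z. *)
Definition liftX (p : {poly K}) : KXYZ := (map_poly (@mpolyC 3 K) p).[varX].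
Definition liftXZ (q : {poly {poly K}}) : KXYZ := (map_poly liftX q).[varZ].

Variables (f : {poly K}) (phi : {poly {poly K}}).

Definition surface_eq : KXYZ := liftX f * varY - liftXZ phi.

Definition surface_ring : Type := principal_quot surface_eq.

HB.instance Definition _ := GRing.ComPzRing.on surface_ring.
HB.instance Definition _ := GRing.Lmodule.on surface_ring.

Definition surface_proj : KXYZ -> surface_ring := @pq_proj K KXYZ surface_eq.

HB.instance Definition _ := GRing.Linear.on surface_proj.
HB.instance Definition _ := GRing.RMorphism.on surface_proj.

Definition surface_x : surface_ring := surface_proj varX.
Definition surface_y : surface_ring := surface_proj varY.
Definition surface_z : surface_ring := surface_proj varZ.

(* p(x) and q(x, z) in the surface ring. *)
Definition evalx (p : {poly K}) : surface_ring := surface_proj (liftX p).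
Definition evalxz (q : {poly {poly K}}) : surface_ring := surface_proj (liftXZ q).

End Surface.

Arguments surface_x {K f phi}.
Arguments surface_y {K f phi}.
Arguments surface_z {K f phi}.
Arguments evalx {K f phi} p.
Arguments evalxz {K f phi} q.

Section SurfaceTheory.
Variable K : fieldType.

Fact liftX_is_zmod_morphism : zmod_morphism (@liftX K).
Proof. by move=> p q; rewrite /liftX rmorphB /= hornerD hornerN. Qed.
Fact liftX_is_monoid_morphism : monoid_morphism (@liftX K).
Proof. by split=> [|p q]; rewrite /liftX ?rmorph1 ?hornerC // rmorphM hornerM. Qed.
HB.instance Definition _ :=
  GRing.isZmodMorphism.Build {poly K} {mpoly K[3]} (@liftX K) liftX_is_zmod_morphism.
HB.instance Definition _ :=
  GRing.isMonoidMorphism.Build {poly K} {mpoly K[3]} (@liftX K) liftX_is_monoid_morphism.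

Fact liftXZ_is_zmod_morphism : zmod_morphism (@liftXZ K).
Proof. by move=> p q; rewrite /liftXZ rmorphB /= hornerD hornerN. Qed.
Fact liftXZ_is_monoid_morphism : monoid_morphism (@liftXZ K).
Proof. by split=> [|p q]; rewrite /liftXZ ?rmorph1 ?hornerC // rmorphM hornerM. Qed.
HB.instance Definition _ :=
  GRing.isZmodMorphism.Build {poly {poly K}} {mpoly K[3]} (@liftXZ K) liftXZ_is_zmod_morphism.
HB.instance Definition _ :=
  GRing.isMonoidMorphism.Build {poly {poly K}} {mpoly K[3]} (@liftXZ K) liftXZ_is_monoid_morphism.

Lemma liftX_C (c : K) : liftX c%:P = c%:MP.
Proof. by rewrite /liftX map_polyC hornerC. Qed.
Lemma liftX_X : liftX 'X = varX K.
Proof. by rewrite /liftX map_polyX hornerX. Qed.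
Lemma liftXZ_C (p : {poly K}) : liftXZ p%:P = liftX p.
Proof. by rewrite /liftXZ map_polyC hornerC. Qed.
Lemma liftXZ_X : liftXZ 'X = varZ K.
Proof. by rewrite /liftXZ map_polyX hornerX. Qed.

Lemma mderiv_var (i j : 'I_3) : ('X_j : {mpoly K[3]})^`M(i) = (i == j)%:R.
Proof.
rewrite mderivX mnm1E eq_sym; case: eqVneq => [->|_]; last by rewrite scale0r.
rewrite (_ : (U_(j) - U_(j))%MM = 0%MM) ?mpolyX0 ?scale1r //.
by apply/mnmP => k; rewrite mnmBE subnn mnm0E.
Qed.

Lemma mderiv_liftX (i : 'I_3) (p : {poly K}) :
  i != inord 0 -> (liftX p)^`M(i) = 0.
Proof.
move=> i_neq; elim/poly_ind: p => [|p c IH]; first by rewrite rmorph0 mderiv0.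
rewrite rmorphD rmorphM /= liftX_X liftX_C mderivD mderivM IH mderivC mderiv_var.
by rewrite (negPf i_neq) mul0r mulr0 !addr0.
Qed.

Lemma mderivY_liftXZ (q : {poly {poly K}}) : (liftXZ q)^`M(inord 1) = 0.
Proof.
elim/poly_ind: q => [|q p IH]; first by rewrite rmorph0 mderiv0.
rewrite rmorphD rmorphM /= liftXZ_X liftXZ_C mderivD mderivM IH mderiv_var.
by rewrite mderiv_liftX -!val_eqE /= !inordK // mul0r mulr0 !addr0.
Qed.

Lemma mderivZ_liftXZ (q : {poly {poly K}}) :
  (liftXZ q)^`M(inord 2) = liftXZ q^`().
Proof.
elim/poly_ind: q => [|q p IH]; first by rewrite deriv0 rmorph0 mderiv0.
rewrite derivD derivM derivX derivC mulr1 addr0.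
rewrite !rmorphD !rmorphM /= liftXZ_X liftXZ_C mderivD mderivM IH mderiv_var eqxx.
by rewrite mderiv_liftX -?val_eqE /= ?inordK // mulr1 addr0.
Qed.

(* phi_Z d/dY + f d/dZ kills the equation of the surface, hence induces a
   derivation of the quotient. *)
Lemma surface_derivation_exists (f : {poly K}) (phi : {poly {poly K}}) :
  exists D : surface_ring f phi -> surface_ring f phi,
    [/\ derivation D, scalable D, D surface_x = 0,
        D surface_y = evalxz phi^`() & D surface_z = evalx f].
Proof.
pose Delta (p : {mpoly K[3]}) :=
  liftXZ phi^`() * p^`M(inord 1) + liftX f * p^`M(inord 2).
have DeltaM p q : Delta (p * q) = Delta p * q + p * Delta q.
  by rewrite /Delta !mderivM !mulrDr !mulrDl addrACA -!mulrA !(mulrCA p).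
have DeltaD p q : Delta (p + q) = Delta p + Delta q.
  by rewrite /Delta !mderivD !mulrDr addrACA.
have DeltaN p : Delta (- p) = - Delta p.
  by rewrite /Delta !mderivN !mulrN opprD.
have Delta0 : Delta (surface_eq f phi) = 0.
  rewrite /Delta /surface_eq !mderivB !mderivM !mderiv_liftX -?val_eqE /= ?inordK //.
  rewrite mderivY_liftXZ mderivZ_liftXZ !mderiv_var -!val_eqE /= !inordK //.
  by rewrite !mul0r !mulr0 !mulr1 !add0r subr0 mulrN mulrC subrr.
pose D (b : surface_ring f phi) := surface_proj f phi (Delta (repr b)).
have DE a : D (surface_proj f phi a) = surface_proj f phi (Delta a).
  have [q hq] : exists q, a - repr (surface_proj f phi a) = q * surface_eq f phi.
    by apply/pq_projE; rewrite pq_projK.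
  apply/esym/pq_projE; exists (Delta q).
  by rewrite -DeltaN -DeltaD hq DeltaM Delta0 mulr0 addr0.
have ind (P : surface_ring f phi -> Prop) :
    (forall a, P (surface_proj f phi a)) -> forall x, P x by exact: pq_ind.
exists D; split.
- split; elim/ind=> a; elim/ind=> b.
    by rewrite -raddfD !DE DeltaD raddfD.
  by rewrite -[_ * _](rmorphM (surface_proj f phi)) !DE DeltaM raddfD /= !(rmorphM (surface_proj f phi)).
- move=> c; elim/ind=> a; rewrite -linearZ !DE -linearZ /Delta /=.
  by rewrite !linearZ /= -!scalerAr -scalerDr linearZ.
- by rewrite DE /Delta !mderiv_var -!val_eqE /= !inordK // !mulr0 addr0 raddf0.
- by rewrite DE /Delta !mderiv_var -!val_eqE /= !inordK // mulr1 mulr0 addr0.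
- by rewrite DE /Delta !mderiv_var -!val_eqE /= !inordK // mulr1 mulr0 add0r.
Qed.
End SurfaceTheory.

(* Main.v *)
From HB Require Import structures.
Require Import Defs.
From mathcomp Require Import all_boot all_algebra.
From mathcomp Require Import boolp mpoly.
From mathcomp Require Import zify ring.
Set Implicit Arguments.
Unset Strict Implicit.
Unset Printing Implicit Defensive.
Import GRing.Theory.
Local Open Scope ring_scope.

(** That every [h D] with [h] in [K[x]] is locally nilpotent is immediate: [D]
    kills [x], and [z] and [y] are sent into [K[x]] and [K[x, z]].

    Conversely, let [E] be locally nilpotent and nonzero. The surface ring [B]
    lies in [K(x)[z]], with [y = phi / f]. Order monomials first by the exponent
    of [z] and then by that of [x]; the leading exponent of an element is then a
    valuation on [B] with values in Z^2 and residue field [K]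
    ([lead_dominance]). Since [B] is free over [K[x]] on the elements
    [y^i z^j] with [j < d], which have distinct degrees in [z] ([nf_surj],
    [nf_inj]), the values taken on [B] are known: they form the monoid generated
    by the values of [x], [z] and [y], the last of which is that of
    [z^d / x^r].

    The shift from the value of [b] to that of [E b] is bounded, with the maximum
    attained at a generator [t] ([shift_bound], [max_shift_exists]). The elements
    for which the shift is maximal are detected by the leading coefficient of
    [E b / b], which is additive in [b]; local nilpotency forces these
    coefficients to be natural multiples of one constant, so that they amount to
    a weight on values which the maximal shift lowers by exactly one
    ([leading_weight]). This is the homogeneous locally nilpotent derivation
    induced on the associated graded ring, in terms of values only. An inspection
    of the monoid of values, where [r > 1] and [d > 1] enter, leaves only maximal
    shifts that lower the degree in [z] ([LND_zsize]). The order being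
    lexicographic, [E] itself lowers the degree in [z]: hence [E x = 0] and [E z]
    lies in [K[x]]. Applying [E] to [f(x) y = phi(x, z)] and comparing leading
    coefficients shows that [f] divides [E z], and [E] is the multiple
    [(E z / f) D] of [D] ([LND_shape]). *)

(** * Derivations *)

Section DerivationTheory.
Variables (A : comPzRingType) (E : A -> A) (E_der : derivation E).

Lemma derD a b : E (a + b) = E a + E b.
Proof. exact: (proj1 E_der). Qed.

Lemma derM a b : E (a * b) = E a * b + a * E b.
Proof. exact: (proj2 E_der). Qed.

Lemma der0 : E 0 = 0.
Proof. by apply: (addrI (E 0)); rewrite -derD !addr0. Qed.

Lemma der1 : E 1 = 0.
Proof.
by apply: (addrI (E 1)); rewrite addr0 -[in RHS](mulr1 1) derM mulr1 mul1r.
Qed.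

Lemma iter_der0 n : iter n E 0 = 0.
Proof. by elim: n => //= n ->; apply: der0. Qed.

Lemma iter_derD n a b : iter n E (a + b) = iter n E a + iter n E b.
Proof. by elim: n => //= n ->; apply: derD. Qed.

Lemma iter_der_le m n a : (m <= n)%N -> iter m E a = 0 -> iter n E a = 0.
Proof. by move=> /subnK <- h; rewrite iterD h iter_der0. Qed.

Lemma iter_der_mul0 m n a b :
  iter m E a = 0 -> iter n E b = 0 -> iter (m + n) E (a * b) = 0.
Proof.
elim: m n a b => [|m IHm] n a b.
  by move=> ha _; rewrite (ha : a = 0) mul0r iter_der0.
elim: n b => [|n IHn] b ha hb.
  by rewrite (hb : b = 0) mulr0 iter_der0.
rewrite addSn iterSr derM iter_derD IHm -?iterSr // add0r.
by rewrite -addSnnS IHn // -iterSr.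
Qed.

(** Only one term of the Leibniz expansion survives when the order of the
    derivative is the sum of the two nilpotency degrees. *)
Lemma iter_der_mul_top m n a b :
    iter m.+1 E a = 0 -> iter n.+1 E b = 0 ->
  iter (m + n) E (a * b) = 'C(m + n, m)%:R * (iter m E a * iter n E b).
Proof.
elim: m n a b => [|m IHm] n a b.
  move=> /= Ea _; rewrite bin0 mul1r add0n.
  by elim: n => //= n ->; rewrite derM Ea mul0r add0r.
elim: n b => [|n IHn] b ha hb.
  rewrite addn0 binn mul1r; have Eb : E b = 0 by [].
  have Ek k : iter k E (a * b) = iter k E a * b.
    by elim: k => //= k ->; rewrite derM Eb mulr0 addr0.
  exact: Ek.
rewrite addSn iterSr derM iter_derD IHm -?iterSr // -addSnnS IHn -?iterSr //.
by rewrite binS natrD mulrDl addrC.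
Qed.

(** Were [a] not a constant, the top derivative of [a * b = 1] would be a
    nonzero derivative of [1] by the previous lemma. *)
Lemma LND_unit0 a b :
    (forall u v : A, u * v = 0 -> u = 0 \/ v = 0) ->
    (forall n, n.+1%:R != 0 :> A) ->
  locally_nilpotent E -> a * b = 1 -> E a = 0.
Proof.
move=> dom char0 E_nil ab1.
have [a1 b1] : a != 0 /\ b != 0.
  split; apply: contraTneq (char0 0) => c0;
    by rewrite -ab1 c0 ?(mulr0, mul0r) eqxx.
have top u : u != 0 -> exists n, iter n E u != 0 /\ iter n.+1 E u = 0.
  move=> u0; have ex : exists n, iter n E u == 0.
    by have [n hn] := E_nil u; exists n; apply/eqP.
  case: (ex_minnP ex) => -[|n] /eqP hn min.
    by move: u0; rewrite (hn : u = 0) eqxx.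
  by exists n; split=> //; apply/negP => /min; rewrite ltnn.
have [[m [m0 m1]] [n [n0 n1]]] := (top a a1, top b b1).
have := iter_der_mul_top m1 n1; rewrite ab1.
case: m m0 m1 => [_ //|m] m0 m1.
rewrite addSn iterSr der1 iter_der0 => /esym/dom[|/dom[]] => [|/eqP|/eqP].
- have: (0 < 'C((m + n).+1, m.+1))%N by rewrite bin_gt0; lia.
  by case: 'C(_, _) => // k _ /eqP; rewrite (negPf (char0 k)).
- by rewrite (negPf m0).
- by rewrite (negPf n0).
Qed.

End DerivationTheory.

(** * Leading parts of locally nilpotent derivations *)

Section Dominance.
Variables (K : fieldType) (B : comPzRingType) (cK : {rmorphism K -> B}).
Implicit Types (a b c : B) (k l : K).

(** The preorder [v a <= v b] of a valuation [v] with residue field [K], the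
    zero element being below all others. [dom_residue] is the statement on the
    residue field: if [a / b] has value at most that of [1], it is a constant up
    to an element of smaller value. *)
Record dominance (le : rel B) : Prop := Dominance {
  dom_trans : transitive le;
  dom_total : total le;
  dom_0l : forall a, le 0 a;
  dom_eq0 : forall a, le a 0 -> a = 0;
  dom_mul2r : forall c a b, c <> 0 -> le (a * c) (b * c) = le a b;
  dom_add : forall a b c, le a c -> le b c -> le (a + b) c;
  dom_const : forall k a, le (cK k * a) a;
  dom_residue :
    forall a b, b <> 0 -> le a b -> exists k, ~~ le b (a - cK k * b) }.

Variable le : rel B.
Hypothesis le_dom : dominance le.

Local Notation "a ≼ b" := (le a b) (at level 70).
Local Notation "a ≺ b" := (~~ le b a) (at level 70).

Lemma dom_ltW a b : a ≺ b -> a ≼ b.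
Proof. by case/orP: (dom_total le_dom a b) => // -> . Qed.

Lemma dom_refl a : a ≼ a.
Proof. by case/orP: (dom_total le_dom a a). Qed.

Lemma dom_le_lt_trans b a c : a ≼ b -> b ≺ c -> a ≺ c.
Proof. by move=> ab; apply: contra => ca; apply: dom_trans ca ab. Qed.

Lemma dom_lt_le_trans b a c : a ≺ b -> b ≼ c -> a ≺ c.
Proof. by move=> ab bc; apply: contra ab; apply: dom_trans bc. Qed.

Lemma dom_lt_add a b c : a ≺ c -> b ≺ c -> a + b ≺ c.
Proof.
move=> ac bc; case/orP: (dom_total le_dom a b) => h.
  by apply: dom_le_lt_trans bc; apply: dom_add => //; apply: dom_refl.
by apply: dom_le_lt_trans ac; apply: dom_add => //; apply: dom_refl.
Qed.

Lemma dom_gt0 a b : a ≺ b -> b <> 0.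
Proof. by move=> ab b0; move: ab; rewrite b0 (dom_0l le_dom). Qed.

Lemma dom_mul2l c a b : c <> 0 -> (c * a ≼ c * b) = (a ≼ b).
Proof. by rewrite ![c * _]mulrC; apply: dom_mul2r. Qed.

Lemma dom_mulr_le c a b : a ≼ b -> a * c ≼ b * c.
Proof.
move=> ab; have [->|/eqP c0] := eqVneq c 0; last by rewrite dom_mul2r.
by rewrite !mulr0 dom_refl.
Qed.

Lemma dom_mull_le c a b : a ≼ b -> c * a ≼ c * b.
Proof. by rewrite ![c * _]mulrC; apply: dom_mulr_le. Qed.

Lemma dom_integral a b : a * b = 0 -> a = 0 \/ b = 0.
Proof.
move=> ab0; have [|/eqP b0] := eqVneq b 0; first by right.
left; apply: (dom_eq0 le_dom); rewrite -(dom_mul2r le_dom a 0 b0).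
by rewrite ab0 mul0r dom_refl.
Qed.

Lemma dom_mul_neq0 a b : a <> 0 -> b <> 0 -> a * b <> 0.
Proof. by move=> a0 b0 /dom_integral[]. Qed.

Lemma dom_const_eqv k b : k != 0 -> b ≼ cK k * b.
Proof.
move=> k0; rewrite -[X in X ≼ _]mul1r -(rmorph1 cK) -(mulVf k0) rmorphM -mulrA.
exact: dom_const.
Qed.

(** Among finitely many nonzero elements, some [t] has the largest shift from
    [g] to [E g]; the shifts being compared are quotients [E g / g], hence the
    cross-multiplied form. *)
Lemma dom_max_shift (E : B -> B) (g0 : B) (s : seq B) :
    (forall g, g \in g0 :: s -> g <> 0) ->
  exists2 t, t \in g0 :: s & forall g, g \in g0 :: s -> E g * t ≼ g * E t.
Proof.
elim: s g0 => [|g1 s IHs] g0 neq0.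
  exists g0; rewrite ?mem_head // => g; rewrite inE => /eqP->.
  by rewrite mulrC dom_refl.
have [|t t_in t_max] := IHs g1.
  by move=> g gs; apply: neq0; rewrite inE gs orbT.
case/orP: (dom_total le_dom (E g0 * t) (g0 * E t)) => h.
  exists t; first by rewrite inE t_in orbT.
  by move=> g; rewrite inE => /predU1P[->|/t_max].
exists g0; first exact: mem_head.
move=> g; rewrite inE => /predU1P[->|/t_max gt]; first by rewrite mulrC dom_refl.
have t0 : t <> 0 by apply: neq0; rewrite inE t_in orbT.
rewrite -(dom_mul2r le_dom _ _ t0).
apply: (dom_trans le_dom) (_ : _ ≼ g * E t * g0) _.
  by rewrite mulrAC; apply: dom_mulr_le.
by rewrite -!mulrA; apply: dom_mull_le; rewrite [E t * _]mulrC.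
Qed.

Section LeadingSlope.
Variables (E : B -> B) (t : B).
Hypotheses (E_der : derivation E) (E_nil : locally_nilpotent E).
Hypothesis E_const : forall k, E (cK k) = 0.
Hypothesis Et_neq0 : E t <> 0.
Hypothesis t_max : forall b, E b * t ≼ b * E t.
Hypothesis K_char0 : [pchar K] =i pred0.

(** [slope b k] says that [k] is the leading coefficient of the logarithmic
    derivative [E b / b], measured in units of [E t / t]. *)
Definition slope b k := t * E b - cK k * (b * E t) ≺ b * E t.

Lemma t_neq0 : t <> 0.
Proof. by move=> t0; apply: Et_neq0; rewrite t0 (der0 E_der). Qed.

Lemma slope_neq0 b k : slope b k -> b <> 0.
Proof. by move=> /dom_gt0 bs b0; apply: bs; rewrite b0 mul0r. Qed.

Lemma slope_exists b : b <> 0 -> exists k, slope b k.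
Proof.
move=> b0; apply: (dom_residue le_dom).
  exact: dom_mul_neq0.
by rewrite mulrC t_max.
Qed.

Lemma slope_unique b k l : slope b k -> slope b l -> k = l.
Proof.
move=> bk bl; apply/eqP; rewrite -subr_eq0; apply/negPn/negP => kl0.
have bs0 := dom_gt0 bk.
have h : cK (k - l) * (b * E t) ≺ b * E t.
  have -> : cK (k - l) * (b * E t) =
      (t * E b - cK l * (b * E t)) + cK (-1) * (t * E b - cK k * (b * E t)).
    by rewrite rmorphB rmorphN rmorph1; ring.
  apply: dom_lt_add => //; apply: dom_le_lt_trans bk; exact: dom_const.
by rewrite dom_const_eqv in h.
Qed.

Lemma slope_mul a b k l : slope a k -> slope b l -> slope (a * b) (k + l).
Proof.
move=> ak bl; have [a0 b0] := (slope_neq0 ak, slope_neq0 bl).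
rewrite /slope (derM E_der) rmorphD.
have -> : t * (E a * b + a * E b) - (cK k + cK l) * (a * b * E t) =
   (t * E a - cK k * (a * E t)) * b + a * (t * E b - cK l * (b * E t)) by ring.
apply: dom_lt_add.
  have -> : a * b * E t = (a * E t) * b by ring.
  by rewrite dom_mul2r.
by rewrite -mulrA dom_mul2l.
Qed.

(** The slope depends on the value of [b] only: elements of equal value differ
    by a constant factor and by lower terms, which [E] keeps low. *)
Lemma slope_eqv a b k : a ≼ b -> b ≼ a -> slope a k -> slope b k.
Proof.
move=> ab ba ak; have a0 := slope_neq0 ak.
have [l bl] := dom_residue le_dom a0 ba.
set e := b - cK l * a in bl; have be : b = cK l * a + e by rewrite addrC subrK.
have s_lt u v : u ≺ v -> u * E t ≺ v * E t by rewrite dom_mul2r.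
have abs : a * E t ≼ (cK l * a + e) * E t by rewrite -be dom_mulr_le.
rewrite /slope be (derD E_der) (derM E_der) E_const mul0r add0r.
have -> : t * (cK l * E a + E e) - cK k * ((cK l * a + e) * E t) =
   cK l * (t * E a - cK k * (a * E t)) + (t * E e - cK k * (e * E t)) by ring.
apply: dom_lt_le_trans abs; apply: dom_lt_add.
  by apply: dom_le_lt_trans ak; apply: dom_const.
apply: dom_le_lt_trans (s_lt _ _ bl); apply: (dom_add le_dom).
  by rewrite mulrC t_max.
by rewrite -mulNr -rmorphN; apply: dom_const.
Qed.

(** Where the slope does not vanish, the bound [t_max] is attained: [E] shifts
    the value of [b] by exactly the shift from [t] to [E t]. *)
Lemma slope_neq0_eqv b k : slope b k -> k != 0 ->
  t * E b ≼ b * E t /\ b * E t ≼ t * E b.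
Proof.
move=> bk k0; split; first by rewrite mulrC t_max.
apply: dom_trans (dom_const_eqv (b * E t) k0) _; first exact: le_dom.
apply/negPn/negP => h.
have {}h : t * E b ≺ b * E t.
  by apply: dom_lt_le_trans h _; apply: dom_const.
have : cK k * (b * E t) ≺ b * E t.
  have -> : cK k * (b * E t) = t * E b + cK (-1) * (t * E b - cK k * (b * E t)).
    by rewrite rmorphN rmorph1; ring.
  by apply: dom_lt_add => //; apply: dom_le_lt_trans bk; apply: dom_const.
by rewrite dom_const_eqv.
Qed.

Lemma slope_t : slope t 1.
Proof.
rewrite /slope rmorph1 mul1r subrr; apply/negP => /(dom_eq0 le_dom).
exact: dom_mul_neq0 t_neq0 Et_neq0.
Qed.

(** The elements [t * E b] and [b * E t] have the same value, hence the same
    slope, and [t] has slope [1]. *)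
Lemma slope_der b k l : slope b k -> k != 0 -> slope (E t) (1 + l) ->
  slope (E b) (k + l).
Proof.
move=> bk k0 sl; have [tb bt] := slope_neq0_eqv bk k0.
have b0 := slope_neq0 bk.
have : E b <> 0.
  move=> Eb0; apply: (@dom_mul_neq0 b (E t)) => //.
  by apply: (dom_eq0 le_dom); rewrite Eb0 mulr0 in bt.
move=> /slope_exists[m Ebm].
have h1 := slope_mul slope_t Ebm.
have h2 := slope_eqv bt tb (slope_mul bk sl).
have e := slope_unique h1 h2.
have -> : k + l = m by apply: (@addrI _ 1); rewrite e; ring.
exact: Ebm.
Qed.

Lemma slope_iter b k l n : slope b k -> slope (E t) (1 + l) ->
  (forall i, (i < n)%N -> k + l *+ i != 0) -> slope (iter n E b) (k + l *+ n).
Proof.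
move=> bk sl; elim: n => [|n IHn] h; first by rewrite addr0.
rewrite iterS mulrSr addrA; apply: slope_der => //; last exact: h.
by apply: IHn => i /ltnW; apply: h.
Qed.

(** As long as the slopes along the orbit of [b] do not vanish, neither do the
    iterates of [E]; a nilpotent orbit must therefore meet slope [0]. *)
Lemma slope_nilpotent b k l : slope b k -> slope (E t) (1 + l) ->
  exists n, k + l *+ n = 0.
Proof.
move=> bk sl; have [N EN0] := E_nil b.
pose P i := k + l *+ i == 0.
have [/hasP[n _ /eqP h]|/hasPn h] := boolP (has P (iota 0 N)).
  by exists n.
have := @slope_iter b k l N bk sl; rewrite EN0.
by case/(_ _)/slope_neq0 => // i iN; apply: h; rewrite mem_iota.
Qed.

Lemma mulrn_char0_inj k : k != 0 -> injective (GRing.natmul k).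
Proof.
move=> k0; have aux m n : (m <= n)%N -> k *+ m = k *+ n -> (n <= m)%N.
  move=> mn /eqP; rewrite eq_sym -subr_eq0 -mulrnBr // -mulr_natr mulf_eq0.
  by rewrite (negPf k0) (iffLR (pcharf0P K) K_char0) subn_eq0.
move=> m n e; apply/eqP; rewrite eqn_leq.
by case/orP: (leq_total m n) => h; rewrite h (aux _ _ h).
Qed.

(** The leading part of [E] acts on values like a locally nilpotent derivation
    that lowers a weight by one. In characteristic zero, [slope_nilpotent] turns
    slopes into natural multiples [psi] of one constant; each application of [E]
    uses up one unit of [psi]. *)
Lemma leading_weight : exists psi : B -> nat,
  [/\ forall a b, a <> 0 -> b <> 0 -> psi (a * b) = (psi a + psi b)%N,
      forall a b, a <> 0 -> a ≼ b -> b ≼ a -> psi a = psi b,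
      forall b, b <> 0 -> (0 < psi b)%N ->
        t * E b ≼ b * E t /\ b * E t ≼ t * E b
    & psi t = (psi (E t)).+1].
Proof.
have [m slm] := slope_exists Et_neq0.
pose l := m - 1; have sl : slope (E t) (1 + l) by rewrite addrC subrK.
have l0 : l != 0.
  have [n] := slope_nilpotent slope_t sl.
  by apply: contra_eq_neq => ->; rewrite mul0rn addr0 oner_neq0.
have ex b : exists n, b <> 0 -> slope b (- (l *+ n)).
  have [->|/eqP b0] := eqVneq b 0; first by exists 0%N.
  have [k bk] := slope_exists b0; have [n kn] := slope_nilpotent bk sl.
  exists n => _; rewrite (_ : - _ = k) //.
  by apply/esym/eqP; rewrite -addr_eq0 kn.
have [psi psiP] := choice ex.
have psi_eq b n : slope b (- (l *+ n)) -> psi b = n.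
  move=> bn; have b0 := slope_neq0 bn; apply: (mulrn_char0_inj l0).
  by apply: oppr_inj; apply: slope_unique (psiP b b0) bn.
exists psi; split.
- move=> a b a0 b0; apply: psi_eq; rewrite mulrnDr opprD.
  by apply: slope_mul; apply: psiP.
- by move=> a b a0 ab ba; apply/esym/psi_eq/(slope_eqv ab ba)/psiP.
- move=> b b0 pb; apply: slope_neq0_eqv (psiP b b0) _.
  rewrite oppr_eq0 -[X in _ != X](mulr0n l).
  by rewrite (inj_eq (mulrn_char0_inj l0)) -lt0n.
- apply: psi_eq; have -> : - (l *+ (psi (E t)).+1) = 1.
    rewrite mulrSr opprD -(slope_unique sl (psiP _ Et_neq0)) addrK //.
  exact: slope_t.
Qed.

End LeadingSlope.
End Dominance.

(** * Generators of the surface ring and the subring K[x, z] *)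

HB.instance Definition _ (K : fieldType) f phi :=
  GRing.RMorphism.copy (@evalx K f phi) (surface_proj f phi \o @liftX K).
HB.instance Definition _ (K : fieldType) f phi :=
  GRing.RMorphism.copy (@evalxz K f phi) (surface_proj f phi \o @liftXZ K).

Lemma polyZXn_ind (R : nzRingType) (P : {poly R} -> Prop) : P 0 ->
    (forall a b, P a -> P b -> P (a + b)) -> (forall p n, P (p *: 'X^n)) ->
  forall c, P c.
Proof. by move=> P0 PD PX c; rewrite -[c]coefK poly_def; apply: big_ind. Qed.

Section SurfaceRing.
Variables (K : fieldType) (f : {poly K}) (phi : {poly {poly K}}).
Local Notation B := (surface_ring f phi).
Local Notation x := (surface_x : B).
Local Notation y := (surface_y : B).
Local Notation z := (surface_z : B).
Local Notation evx := (evalx : _ -> B).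
Local Notation ev := (evalxz : _ -> B).

Lemma evalxz_C (p : {poly K}) : ev p%:P = evx p.
Proof. by rewrite /evalxz liftXZ_C. Qed.

Lemma evalxz_Z : ev 'X = z.
Proof. by rewrite /evalxz liftXZ_X. Qed.

Lemma evalx_X : evx 'X = x.
Proof. by rewrite /evalx liftX_X. Qed.

Lemma surface_relation : evx f * y = ev phi.
Proof.
apply/eqP; rewrite -subr_eq0 -[y]/(surface_proj f phi (varY K)) /evalx /evalxz.
rewrite -rmorphM -rmorphB -[X in _ == X](rmorph0 (surface_proj f phi)).
by apply/eqP/pq_projE; exists 1; rewrite subr0 mul1r.
Qed.

Definition constK (k : K) : B := evx k%:P.

HB.instance Definition _ := GRing.RMorphism.copy constK (evalx \o @polyC K).

Lemma scale_constK (k : K) (b : B) : k *: b = constK k * b.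
Proof.
elim/(@pq_ind _ _ (surface_eq f phi)): b => a.
rewrite -[pq_proj _ a]/(surface_proj f phi a) /constK /evalx liftX_C -rmorphM.
by rewrite mul_mpolyC; apply/esym/pq_projZ.
Qed.

(** The monomials [x^m y^i z^j] span the ring, and each is built up one factor at
    a time. *)
Lemma surface_ind (P : B -> Prop) :
    (forall k, P (constK k)) -> (forall a b, P a -> P b -> P (a + b)) ->
    (forall b, P b -> P (x * b)) -> (forall b, P b -> P (y * b)) ->
    (forall b, P b -> P (z * b)) ->
  forall b, P b.
Proof.
move=> Pc Pa Px Py Pz; elim/(@pq_ind _ _ (surface_eq f phi)) => q.
rewrite -[pq_proj _ q]/(surface_proj f phi q).
have Pexp (u b : B) n : (forall b, P b -> P (u * b)) -> P b -> P (u ^+ n * b).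
  by move=> Pu Pb; elim: n => [|n IHn]; rewrite ?mul1r // exprS -mulrA; apply: Pu.
rewrite [q]mpolyE raddf_sum /=; elim/big_ind: _ => //.
  by rewrite -(rmorph0 constK).
move=> m _; rewrite [surface_proj _ _ _]pq_projZ.
rewrite -[pq_scale _ _]/(q@_m *: surface_proj f phi 'X_[m]) scale_constK.
rewrite mpolyXE_id rmorph_prod /=.
rewrite !big_ord_recl big_ord0 /= mulr1 !rmorphXn /= mulrC -!mulrA.
have -> : (ord0 : 'I_3) = inord 0 by apply/val_inj; rewrite /= inordK.
have -> : lift (inord 0) ord0 = inord 1 :> 'I_3.
  by apply/val_inj; rewrite /= /bump !inordK.
have -> : lift (inord 0) (lift ord0 ord0) = inord 2 :> 'I_3.
  by apply/val_inj; rewrite /= /bump !inordK.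
by apply/(Pexp x)/(Pexp y)/(Pexp z)/Pc.
Qed.

Lemma der_gen_eq (D E : B -> B) : derivation D -> derivation E ->
    (forall k, D (constK k) = E (constK k)) ->
    D x = E x -> D y = E y -> D z = E z ->
  forall b, D b = E b.
Proof.
move=> D_der E_der Dc Dx Dy Dz; elim/surface_ind => [//|a b Da Db|b Db|b Db|b Db].
- by rewrite (derD D_der) (derD E_der) Da Db.
- by rewrite (derM D_der) (derM E_der) Dx Db.
- by rewrite (derM D_der) (derM E_der) Dy Db.
- by rewrite (derM D_der) (derM E_der) Dz Db.
Qed.

Lemma der_constK (D : B -> B) k : derivation D -> scalable D -> D (constK k) = 0.
Proof.
move=> D_der D_lin; rewrite -[constK k]mulr1 -scale_constK D_lin.
by rewrite (der1 D_der) scaler0.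
Qed.

(** The elements killed by a power of a derivation form a subring, so
    nilpotency need only be tested on generators. *)
Lemma locally_nilpotent_gen (D : B -> B) : derivation D ->
    (forall k, D (constK k) = 0) -> D x = 0 -> D (D z) = 0 ->
    (exists P, D y = ev P) ->
  locally_nilpotent D.
Proof.
move=> D_der Dc Dx Dz [P Dy].
pose nil b := exists n : nat, iter n D b = 0.
have nilD a b : nil a -> nil b -> nil (a + b).
  move=> [m am] [n bn]; exists (m + n)%N; rewrite (iter_derD D_der).
  rewrite (iter_der_le D_der (leq_addr n m) am).
  by rewrite (iter_der_le D_der (leq_addl m n) bn) addr0.
have nilM a b : nil a -> nil b -> nil (a * b).
  by move=> [m am] [n bn]; exists (m + n)%N; apply: iter_der_mul0.
have nilC k : nil (constK k) by exists 1%N; apply: Dc.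
have nilx : nil x by exists 1%N.
have nilz : nil z by exists 2%N.
have nil_evx p : nil (evx p).
  elim/poly_ind: p => [|p c IHp]; first by exists 0%N; rewrite rmorph0.
  rewrite (rmorphD evx) (rmorphM evx) /= evalx_X; apply: nilD (nilC c).
  exact: nilM.
have nil_ev Q : nil (ev Q).
  elim/poly_ind: Q => [|Q p IHQ]; first by exists 0%N; rewrite rmorph0.
  rewrite (rmorphD ev) (rmorphM ev) /= evalxz_Z evalxz_C.
  by apply: nilD (nil_evx p); apply: nilM.
have nily : nil y by have [n hn] := nil_ev P; exists n.+1; rewrite iterSr Dy.
by elim/surface_ind => [k|a b|b|b|b];
  [exact: nilC | exact: nilD | exact: nilM | exact: nilM | exact: nilM].
Qed.

(** The isomorphism with K[X][Z][Y], where the equation has degree one in the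
    outer variable. *)
Definition polyY : {mpoly K[3]} -> {poly {poly {poly K}}} :=
  mmap (polyC \o polyC \o polyC)
    (fun i => nth 0 [:: 'X%:P%:P; 'X; 'X%:P] i).

HB.instance Definition _ := GRing.RMorphism.on polyY.

Lemma polyY_liftXZ q : polyY (liftXZ q) = q%:P.
Proof.
have varE i : polyY 'X_i = nth 0 [:: 'X%:P%:P; 'X; 'X%:P] i.
  by rewrite /polyY mmapX mmap1U.
have polyY_liftX (p : {poly K}) : polyY (liftX p) = p%:P%:P.
  elim/poly_ind: p => [|p c IHp]; first by rewrite !rmorph0.
  rewrite 2!rmorphD 2!rmorphM /= IHp liftX_X liftX_C varE inordK //=.
  by rewrite /polyY mmapC /= !polyCD !polyCM.
elim/poly_ind: q => [|q p IHq]; first by rewrite !rmorph0.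
rewrite 2!rmorphD 2!rmorphM /= IHq liftXZ_X liftXZ_C varE inordK //=.
by rewrite polyY_liftX polyCD polyCM.
Qed.

Lemma polyY_surface_eq : polyY (surface_eq f phi) = f%:P%:P * 'X - phi%:P.
Proof.
rewrite /surface_eq rmorphB rmorphM /= -liftXZ_C !polyY_liftXZ /polyY.
by rewrite mmapX mmap1U inordK.
Qed.

(** A nonzero multiple of the equation has positive degree in [Y], hence is not
    a polynomial in [X] and [Z]. *)
Lemma evalxz_inj : f != 0 -> injective ev.
Proof.
move=> f0 p q /pq_projE[s]; move/(congr1 polyY).
rewrite rmorphB rmorphM /= !polyY_liftXZ polyY_surface_eq -polyCB => e.
have sizeE : size (f%:P%:P * 'X - phi%:P : {poly {poly {poly K}}}) = 2%N.
  by rewrite -polyCN size_MXaddC size_polyC !polyC_eq0 (negPf f0).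
have s0 : polyY s = 0.
  apply/eqP/negPn/negP => s0.
  have := congr1 (fun u : {poly _} => size u) e; rewrite size_polyC size_mul //.
    rewrite sizeE; move: s0; rewrite -size_poly_gt0.
    by case: (size (polyY s)) => [//|n]; rewrite addnC; case: (_ != _).
  by rewrite -size_poly_gt0 sizeE.
by move/eqP: e; rewrite s0 mul0r polyC_eq0 subr_eq0 => /eqP.
Qed.

(** * The surface ring as a free module over K[x] *)

Section NormalForm.
Variable d : nat.
Implicit Types (c q P Q : {poly {poly K}}) (p : {poly K}).
Hypotheses (f_monic : f \is monic) (phi_monic : phi \is monic).
Hypotheses (phi_deg : size phi = d.+1) (d_gt0 : (0 < d)%N).

Definition nf_basis n : B := y ^+ (n %/ d) * z ^+ (n %% d).

(** As [phi] is monic of degree [d] in [Z], the surface ring is free over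
    [K[x, y]] on the powers of [z] below [d], hence free over [K[x]] on the
    [nf_basis n]. The exponents are chosen so that, in [K(x)[z]], the n-th basis
    element has degree [n] in [z]; [nf] is the resulting bijection with
    [K[X][Z]], which is linear over [K[x]] but not multiplicative. *)
Definition nf (c : {poly {poly K}}) : B :=
  \sum_(n < size c) evx c`_n * nf_basis n.

Lemma nf_widen N c : (size c <= N)%N -> nf c = \sum_(n < N) evx c`_n * nf_basis n.
Proof.
move=> cN; rewrite /nf (big_ord_widen N (fun n => evx c`_n * nf_basis n)) //.
rewrite big_mkcond; apply: eq_bigr => n _; case: ltnP => // h.
by rewrite nth_default // rmorph0 mul0r.
Qed.

Fact nf_is_zmod_morphism : zmod_morphism nf.
Proof.
move=> a b; pose N := maxn (size (a - b)) (maxn (size a) (size b)).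
rewrite !(@nf_widen N) /N ?leq_max ?leqnn ?orbT // -sumrB.
by apply: eq_bigr => n _; rewrite coefB rmorphB mulrBl.
Qed.
HB.instance Definition _ :=
  GRing.isZmodMorphism.Build {poly {poly K}} B nf nf_is_zmod_morphism.

Lemma nfZ p c : nf (p *: c) = evx p * nf c.
Proof.
rewrite (nf_widen (size_scale_leq p c)) big_distrr /=.
by apply: eq_bigr => n _; rewrite coefZ rmorphM mulrA.
Qed.

Lemma nfXn n : nf 'X^n = nf_basis n.
Proof.
rewrite /nf size_polyXn big_ord_recr /= coefXn eqxx rmorph1 mul1r big1 ?add0r //.
by move=> i _; rewrite coefXn ltn_eqF // rmorph0 mul0r.
Qed.

Lemma nf_basisE i j : (j < d)%N -> nf_basis (i * d + j) = y ^+ i * z ^+ j.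
Proof.
move=> jd; rewrite /nf_basis divnMDl // modnMDl.
by rewrite divn_small // modn_small // addn0.
Qed.

Lemma nf_basis_small j : (j < d)%N -> nf_basis j = z ^+ j.
Proof. by move=> jd; rewrite (nf_basisE 0 jd) mul1r. Qed.

Lemma nf_small q : (size q <= d)%N -> nf q = ev q.
Proof.
move=> qd; rewrite (nf_widen qd) -{2}[q]coefK poly_def.
rewrite (big_ord_widen d (fun n => q`_n *: 'X^n)) // rmorph_sum [RHS]big_mkcond.
apply: eq_bigr => n _; rewrite nf_basis_small //; case: ltnP => h.
  by rewrite -mul_polyC rmorphM rmorphXn /= evalxz_C evalxz_Z.
by rewrite nth_default // rmorph0 mul0r.
Qed.

Lemma nf_shift i c : y ^+ i * nf c = nf (c * 'X^(i * d)).
Proof.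
elim/polyZXn_ind: c => [|a b Ha Hb|p n].
- by rewrite mul0r !raddf0 mulr0.
- by rewrite mulrDl !raddfD /= mulrDr Ha Hb.
rewrite -scalerAl -exprD !nfZ !nfXn mulrCA; congr (_ * _).
rewrite addnC {2}(divn_eq n d) addnA -mulnDl nf_basisE ?ltn_mod //.
by rewrite /nf_basis mulrA exprD.
Qed.

(** The only product that leaves the basis is [z ^+ d], which the relation
    [ev phi = f(x) y] rewrites. *)
Lemma nf_surj b : exists c, nf c = b.
Proof.
have imD a a' : (exists c, nf c = a) -> (exists c, nf c = a') ->
    exists c, nf c = a + a'.
  by move=> [c <-] [c' <-]; exists (c + c'); rewrite raddfD.
have imZ p a : (exists c, nf c = a) -> exists c, nf c = evx p * a.
  by move=> [c <-]; exists (p *: c); rewrite nfZ.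
have imy i a : (exists c, nf c = a) -> exists c, nf c = y ^+ i * a.
  by move=> [c <-]; eexists; rewrite nf_shift.
elim/surface_ind: b => [k|a b|b|b|b].
- by exists k%:P%:P; rewrite nf_small ?evalxz_C // size_polyC; case: (_ != _).
- exact: imD.
- by rewrite -evalx_X; apply: imZ.
- exact: (imy 1%N).
case=> c <-{b}; elim/polyZXn_ind: c => [|a b Ha Hb|p n].
- by exists 0; rewrite !raddf0 mulr0.
- by rewrite raddfD mulrDr; apply: imD.
rewrite nfZ mulrCA; apply: imZ.
rewrite nfXn /nf_basis mulrCA -exprS; apply: imy.
have : (n %% d < d)%N by rewrite ltn_mod.
rewrite leq_eqVlt => /predU1P[->|jd]; last first.
  by exists 'X^((n %% d).+1); rewrite nfXn nf_basis_small.
have q_small : (size (phi - 'X^d : {poly {poly K}})%R <= d)%N.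
  apply/leq_sizeP => j; rewrite leq_eqVlt => /predU1P[<-|dj].
    have := monicP phi_monic; rewrite lead_coefE phi_deg /= => phi_d.
    by rewrite coefB coefXn eqxx phi_d subrr.
  by rewrite coefB coefXn gtn_eqF // nth_default ?subr0 // phi_deg.
exists (f *: 'X^d - (phi - 'X^d)); rewrite raddfB /= nfZ nfXn (nf_small q_small).
rewrite -{1}[d]mul1n -[(1 * d)%N]addn0 nf_basisE // mulr1 surface_relation.
have -> : ev (phi - 'X^d) = ev phi - z ^+ d.
  rewrite raddfB /=; congr (_ - _).
  by rewrite rmorphXn /= evalxz_Z.
exact: subKr.
Qed.

Section Valuation.
Variable r : nat.
Hypothesis f_deg : size f = r.+1.

Let f_neq0 : f != 0. Proof. exact: monic_neq0. Qed.

(** The polynomial [f ^+ k * nf c] of [K[X][Z]], for [k] large enough to clear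
    the denominators of [y = phi / f]. *)
Definition nf_clear k c : {poly {poly K}} :=
  \sum_(n < size c)
    (c`_n * f ^+ (k - n %/ d))%:P * (phi ^+ (n %/ d) * 'X^(n %% d)).

Lemma nf_clearE k c : (size c <= k)%N -> evx f ^+ k * nf c = ev (nf_clear k c).
Proof.
move=> ck; rewrite /nf big_distrr raddf_sum /=; apply: eq_bigr => n _.
have nk : (n %/ d <= k)%N.
  by apply: leq_trans (leq_div n d) (leq_trans (ltnW (ltn_ord n)) ck).
rewrite !(rmorphM ev) /= !(rmorphXn ev) /= evalxz_Z evalxz_C rmorphM rmorphXn /=.
rewrite -surface_relation exprMn -{1}(subnK nk) exprD /nf_basis.
have mulr_shuffle (s t u v w : B) : s * t * (u * (v * w)) = u * s * (t * v * w).
  by ring.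
exact: mulr_shuffle.
Qed.

(** The terms of [nf_clear k c] have distinct degrees in [Z], as
    [phi ^+ (n %/ d) * 'X^(n %% d)] is monic of degree [n]; the top one cannot
    cancel. *)
Lemma lead_nf_clear k c : c != 0 ->
  size (nf_clear k c) = size c /\
  lead_coef (nf_clear k c) = lead_coef c * f ^+ (k - (size c).-1 %/ d).
Proof.
move=> c0; pose Q n : {poly {poly K}} := phi ^+ (n %/ d) * 'X^(n %% d).
have Q_monic n : Q n \is monic by rewrite monicMr ?monicXn // monic_exp.
have Q_size n : size (Q n) = n.+1.
  rewrite size_Mmonic ?monicXn // ?monic_neq0 ?monic_exp //.
  rewrite size_polyXn -(prednK (_ : 0 < size (phi ^+ _))%N); last first.
    by rewrite size_poly_gt0 monic_neq0 // monic_exp.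
  by rewrite size_exp phi_deg /= mulnC addnS /= {3}(divn_eq n d).
rewrite /nf_clear; have : (0 < size c)%N by rewrite size_poly_gt0.
rewrite [lead_coef c]lead_coefE; case e: (size c) => [//|N] _.
rewrite big_ord_recr /=.
set a := c`_N * f ^+ (k - N %/ d); set S := \sum_(_ < _) _.
have aN : a != 0.
  by rewrite mulf_neq0 ?expf_neq0 // -[N]/(N.+1.-1) -e -lead_coefE lead_coef_eq0.
have top : size (a%:P * Q N) = N.+1 by rewrite size_Cmul.
have S_size : (size S < size (a%:P * Q N)%R)%N.
  rewrite top ltnS; apply: (leq_trans (size_sum _ _ _)).
  apply/bigmax_leqP => i _; rewrite -[_ * 'X^_]/(Q i) mul_polyC.
  by apply: leq_trans (size_scale_leq _ _) _; rewrite Q_size.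
rewrite addrC size_polyDl // lead_coefDl // top; split=> //.
by rewrite lead_coefM lead_coefC (monicP (Q_monic N)) mulr1.
Qed.

Lemma nf_inj : injective nf.
Proof.
move=> a b ab; apply/eqP; rewrite -subr_eq0; apply/negPn/negP => ab0.
have := nf_clearE (leqnn (size (a - b))); rewrite raddfB /= ab subrr mulr0.
rewrite -(rmorph0 ev) => /(evalxz_inj f_neq0)/esym/eqP.
by rewrite -size_poly_eq0 (lead_nf_clear _ ab0).1 size_poly_eq0 (negPf ab0).
Qed.

Definition coord (b : B) : {poly {poly K}} :=
  if pselect (exists c, nf c = b) is left h then projT1 (cid h) else 0.

Lemma coordK : cancel coord nf.
Proof.
move=> b; rewrite /coord; case: pselect => [h|[]]; last exact: nf_surj.
exact: projT2 (cid h).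
Qed.

Lemma nfK : cancel nf coord.
Proof. by move=> c; apply: nf_inj; rewrite coordK. Qed.

Lemma coordB a b : coord (a - b) = coord a - coord b.
Proof. by apply: nf_inj; rewrite raddfB /= !coordK. Qed.

Lemma coordD a b : coord (a + b) = coord a + coord b.
Proof. by apply: nf_inj; rewrite raddfD /= !coordK. Qed.

Lemma coordZ p b : coord (evx p * b) = p *: coord b.
Proof. by apply: nf_inj; rewrite nfZ !coordK. Qed.

Lemma coord0 : coord 0 = 0.
Proof. by apply: nf_inj; rewrite raddf0 coordK. Qed.

(** * The valuation by leading terms *)

(** For [P] with leading term [X^m Z^n], the second component of the value of
    [P] is [d m + r n] instead of [m]. This change of coordinates makes the value
    of [y = phi / f], whose leading term is [Z^d / X^r], equal to [(d, 0)]. *)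
Definition weight (P : {poly {poly K}}) :=
  (d * (size (lead_coef P)).-1 + r * (size P).-1)%N.

(** The value of [b] is the pair [((zsize b).-1, zweight b)]: if
    [coord b] has leading term [X^m Z^n], then [b] has leading term
    [x^m z^n / x^(r (n %/ d))], and [d m + r n - d r (n %/ d)] is
    [d m + r (n %% d)]. Comparing sizes instead of degrees puts zero below all
    other elements. *)
Definition zsize b := size (coord b).
Definition zweight b :=
  (d * (size (lead_coef (coord b))).-1 + r * ((zsize b).-1 %% d))%N.

Lemma weight_mul P Q : P != 0 -> Q != 0 ->
  weight (P * Q) = (weight P + weight Q)%N.
Proof.
move=> P0 Q0; rewrite /weight lead_coefM !size_mul ?lead_coef_eq0 //.
move: P0 Q0; rewrite -(lead_coef_eq0 P) -(lead_coef_eq0 Q) => lP lQ.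
have [P0 Q0] : P != 0 /\ Q != 0 by rewrite -(lead_coef_eq0 P) -(lead_coef_eq0 Q).
move: lP lQ P0 Q0; rewrite -!size_poly_gt0.
move: (size (lead_coef P)) (size (lead_coef Q)) (size P) (size Q).
move=> [//|i] [//|j] [//|k] [//|l] _ _ _ _.
by rewrite !addnS !addSn /=; lia.
Qed.

Lemma weight_nf_clear k c : c != 0 -> (size c <= k)%N ->
  weight (nf_clear k c) =
    (d * (size (lead_coef c)).-1 + r * ((size c).-1 %% d) + d * r * k)%N.
Proof.
move=> c0 ck; have [sE lE] := lead_nf_clear k c0; rewrite /weight sE lE.
have := leq_trans (leq_div (size c).-1 d) (leq_trans (leq_pred _) ck).
move: (divn_eq (size c).-1 d) => nE /subnK; set e := (k - _)%N => kE.
have -> : (size (lead_coef c * f ^+ e)%R).-1 =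
    ((size (lead_coef c)).-1 + r * e)%N.
  rewrite size_Mmonic ?monic_exp ?lead_coef_eq0 //.
  have := size_exp f e; rewrite f_deg /=.
  have : (0 < size (f ^+ e))%N by rewrite size_poly_gt0 expf_neq0.
  have : (0 < size (lead_coef c))%N by rewrite size_poly_gt0 lead_coef_eq0.
  move: (size _) (size _) => [//|i] [//|j] _ _ /= ->.
  by lia.
clearbody e; rewrite -kE; move: nE.
by move: ((size c).-1 %/ d)%N ((size c).-1 %% d)%N => q s ->; ring.
Qed.

(** Values are computed in [K[X][Z]] after clearing denominators; this is where
    multiplicativity comes from, since [nf] itself does not respect products. *)
Lemma valuation_clear k b P : P != 0 -> evx f ^+ k * b = ev P ->
  zsize b = size P /\ (zweight b + d * r * k)%N = weight P.
Proof.
move=> P0 bP; rewrite /zsize /zweight; set c := coord b.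
have c0 : c != 0.
  apply: contra_neq P0 => c0; apply: (evalxz_inj f_neq0).
  by rewrite rmorph0 -bP -(coordK b) -/c c0 raddf0 mulr0.
set N := size c; have fN : (f ^+ N)%:P != 0 :> {poly {poly K}}.
  by rewrite polyC_eq0 expf_neq0.
have E : (f ^+ N)%:P * P = nf_clear (k + N) c.
  apply: (evalxz_inj f_neq0); rewrite -nf_clearE ?leq_addl // coordK.
  by rewrite (rmorphM ev) /= evalxz_C rmorphXn /= -bP mulrA -exprD addnC.
split.
  by rewrite {1}/N -(lead_nf_clear (k + N) c0).1 -E size_Cmul // expf_neq0.
have := weight_nf_clear c0 (leq_addl k N); rewrite -E weight_mul //.
rewrite {1}/weight lead_coefC size_polyC expf_neq0 //= size_exp f_deg /=.
rewrite muln0 addn0 /zsize -/c -/N mulnA mulnDr.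
by move: (weight P) (r * (N.-1 %% d))%N (d * r)%N (d * _)%N; lia.
Qed.

Lemma coord_eq0 (b : B) : (coord b == 0) = (b == 0).
Proof. by rewrite -coord0 (can_eq coordK). Qed.

Lemma zsize_eq0 (b : B) : (zsize b == 0%N) = (b == 0).
Proof. by rewrite /zsize size_poly_eq0 coord_eq0. Qed.

Lemma zsize0 : zsize 0 = 0%N.
Proof. by apply/eqP; rewrite zsize_eq0. Qed.

Lemma zsize_gt0 (b : B) : b <> 0 -> (0 < zsize b)%N.
Proof. by move/eqP; rewrite -zsize_eq0 lt0n. Qed.

Lemma clear_denominator (b : B) : b <> 0 ->
  exists k P, P != 0 /\ evx f ^+ k * b = ev P.
Proof.
move=> /eqP; rewrite -coord_eq0 => b0.
exists (size (coord b)), (nf_clear (size (coord b)) (coord b)).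
rewrite -nf_clearE // coordK; split=> //.
by rewrite -size_poly_eq0 (lead_nf_clear _ b0).1 size_poly_eq0.
Qed.

Lemma valuationM (a b : B) : a <> 0 -> b <> 0 ->
  zsize (a * b) = (zsize a + zsize b).-1 /\
  zweight (a * b) = (zweight a + zweight b)%N.
Proof.
move=> /clear_denominator[k [P [P0 aP]]] /clear_denominator[l [Q [Q0 bQ]]].
have PQ0 : P * Q != 0 by rewrite mulf_neq0.
have abPQ : evx f ^+ (k + l) * (a * b) = ev (P * Q).
  by rewrite (rmorphM ev) /= -aP -bQ exprD; ring.
have [sa wa] := valuation_clear P0 aP; have [sb wb] := valuation_clear Q0 bQ.
have [-> wab] := valuation_clear PQ0 abPQ; split.
  by rewrite size_mul // sa sb.
move: wab; rewrite weight_mul // -wa -wb mulnDr.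
by move: (zweight _) (zweight _) (zweight _) (_ * k)%N (_ * l)%N; lia.
Qed.

Lemma valuation_ev P : P != 0 ->
  zsize (ev P) = size P /\ zweight (ev P) = weight P.
Proof.
move=> P0; have [//|-> <-] := @valuation_clear 0 (ev P) P P0; last first.
  by rewrite muln0 addn0.
by rewrite mul1r.
Qed.

Lemma valuation_x : zsize x = 1%N /\ zweight x = d.
Proof.
have X0 : 'X%:P != 0 :> {poly {poly K}} by rewrite polyC_eq0 polyX_eq0.
rewrite -evalx_X -evalxz_C; have [-> ->] := valuation_ev X0.
rewrite /weight lead_coefC size_polyX size_polyC polyX_eq0.
by rewrite muln1 muln0 addn0.
Qed.

Lemma valuation_z : zsize z = 2%N /\ zweight z = r.
Proof.
have X0 : 'X != 0 :> {poly {poly K}} by rewrite polyX_eq0.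
rewrite -evalxz_Z; have [-> ->] := valuation_ev X0.
by rewrite /weight lead_coefX size_polyX size_poly1 muln1 muln0.
Qed.

Lemma valuation_y : zsize y = d.+1 /\ zweight y = 0%N.
Proof.
have yP : evx f ^+ 1 * y = ev phi by exact: surface_relation.
have [-> ] := valuation_clear (monic_neq0 phi_monic) yP.
rewrite /weight (monicP phi_monic) size_poly1 phi_deg /= => h; split=> //.
by move: h; rewrite muln0 muln1 mulnC; lia.
Qed.

(** In [K(x)[z]] the second component of a value can be any integer congruent to
    [r n] modulo [d]; this bound is what membership in the surface ring adds. *)
Lemma zweight_ge (b : B) : (r * ((zsize b).-1 %% d) <= zweight b)%N.
Proof. exact: leq_addl. Qed.

Local Notation zcoef u n := ((coord u)`_n)%R.

Definition lead_le (a b : B) :=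
  (zsize a < zsize b)%N || (zsize a == zsize b) && (zweight a <= zweight b)%N.

Lemma lead_le_anti a b : lead_le a b -> lead_le b a ->
  zsize a = zsize b /\ zweight a = zweight b.
Proof. by rewrite /lead_le; lia. Qed.

(** In terms of the coefficients at the degree of [b], sums and residues reduce
    to bounds on sizes of polynomials. *)
Lemma lead_leE (a b : B) : lead_le a b =
  (zsize a <= zsize b)%N &&
  (size (zcoef a (zsize b).-1) <= size (zcoef b (zsize b).-1))%N.
Proof.
rewrite /lead_le; case: ltngtP => //= [ab|ab].
  rewrite (@nth_default _ 0 (coord a)) ?size_poly0 //.
  by move: ab; rewrite -/(zsize a); case: (zsize b).
rewrite /zweight -ab leq_add2r leq_pmul2l //.
rewrite {2}ab /zsize -!lead_coefE.
have [a0|] := eqVneq (coord a) 0.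
  move: ab; rewrite /zsize a0 size_poly0 => /esym/eqP; rewrite size_poly_eq0.
  by move/eqP->; rewrite lead_coef0 !leqnn.
move=> a0; have b0 : coord b != 0.
  by move: a0; rewrite -!size_poly_eq0 -/(zsize a) ab.
move: a0 b0; rewrite -(lead_coef_eq0 (coord a)) -(lead_coef_eq0 (coord b)).
rewrite -!size_poly_gt0.
by move: (size (lead_coef (coord a))) (size (lead_coef (coord b))) => [|i] [].
Qed.

Lemma lead_dominance : dominance constK lead_le.
Proof.
split.
- by move=> b a c; rewrite /lead_le; lia.
- by move=> a b; rewrite /lead_le; lia.
- by move=> b; rewrite lead_leE coord0 coef0 /zsize coord0 !size_poly0.
- move=> a; rewrite lead_leE /zsize coord0 size_poly0 leqn0 size_poly_eq0.
  by rewrite coord_eq0 => /andP[/eqP].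
- have zw0 : zweight 0 = 0%N.
    by rewrite /zweight zsize0 coord0 lead_coef0 size_poly0 mod0n !muln0.
  move=> c a b c0; rewrite /lead_le.
  have := zsize_gt0 c0.
  have [->|/eqP a0] := eqVneq a 0; have [->|/eqP b0] := eqVneq b 0.
  + by rewrite !mul0r; lia.
  + have [-> ->] := valuationM b0 c0; have := zsize_gt0 b0.
    by rewrite mul0r zsize0 zw0; lia.
  + have [-> ->] := valuationM a0 c0; have := zsize_gt0 a0.
    by rewrite mul0r zsize0 zw0; lia.
  have [-> ->] := valuationM b0 c0; have := zsize_gt0 b0.
  have [-> ->] := valuationM a0 c0; have := zsize_gt0 a0.
  by lia.
- move=> a b c; rewrite !lead_leE => /andP[ac lac] /andP[bc lbc]; apply/andP.
  rewrite /zsize coordD coefD; split; apply: leq_trans (size_polyD _ _) _;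
    by rewrite geq_max; apply/andP.
- move=> k a; rewrite lead_leE /zsize coordZ coefZ.
  rewrite size_scale_leq mul_polyC /=; exact: size_scale_leq.
move=> a b b0 ab; pose n := (zsize b).-1; pose m := (size (zcoef b n)).-1.
have lead0 : (coord b)`_n`_m != 0.
  by rewrite -!lead_coefE !lead_coef_eq0 coord_eq0; apply/eqP.
(* The quotient of the coefficients at the leading exponent of [b] cancels the
   leading term. *)
pose k := (coord a)`_n`_m / (coord b)`_n`_m; exists k.
apply/negP; rewrite lead_leE.
set e := a - constK k * b => /andP[be lbe].
have /andP[ea lea] : (zsize e <= zsize b)%N &&
    (size (zcoef e n) <= size (zcoef b n))%N.
  have e_coord : coord e = coord a - k%:P *: coord b by rewrite coordB coordZ.
  move: ab; rewrite lead_leE => /andP[sab lab].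
  rewrite /zsize e_coord coefB coefZ mul_polyC; apply/andP; split.
    apply: leq_trans (size_polyD _ _) _; rewrite geq_max sab size_polyN.
    exact: size_scale_leq.
  apply: leq_trans (size_polyD _ _) _; rewrite geq_max lab size_polyN.
  exact: size_scale_leq.
have ebE : zsize e = zsize b by lia.
rewrite ebE -/n in lbe.
have lE : size (zcoef e n) = size (zcoef b n) by lia.
have : (coord e)`_n`_m != 0.
  rewrite /m -lE -lead_coefE lead_coef_eq0 /n -ebE -lead_coefE lead_coef_eq0.
  by rewrite coord_eq0 -zsize_eq0 ebE zsize_eq0; apply/eqP.
by rewrite coordB coordZ !coefB coefZ mul_polyC coefZ /k divfK // subrr eqxx.
Qed.

Lemma evalx_neq0 p : p != 0 -> evx p <> 0.
Proof.
move=> p0; rewrite -evalxz_C -(rmorph0 ev) => /(evalxz_inj f_neq0)/eqP.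
by rewrite polyC_eq0 (negPf p0).
Qed.

Lemma surface_integral (a b : B) : a * b = 0 -> a = 0 \/ b = 0.
Proof. exact: (dom_integral lead_dominance). Qed.

(** Each value of the surface ring is that of a monomial, the product of a power
    of [x] and a basis element. *)
Lemma lead_monomial (b : B) : b <> 0 ->
  exists m i j, let u := x ^+ m * (y ^+ i * z ^+ j) in
    [/\ u <> 0, lead_le b u & lead_le u b].
Proof.
move=> /eqP b0; pose n := (zsize b).-1; pose m := (size (zcoef b n)).-1.
exists m, (n %/ d)%N, (n %% d)%N => u.
have cu : coord u = 'X^m *: 'X^n.
  by rewrite /u -evalx_X -(rmorphXn evx) coordZ -/(nf_basis n) -nfXn nfK.
have sn : zsize b = n.+1 by rewrite prednK // lt0n zsize_eq0.
have sm : size (zcoef b n) = m.+1.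
  by rewrite prednK // size_poly_gt0 -lead_coefE lead_coef_eq0 coord_eq0.
have su : zsize u = n.+1.
  by rewrite /zsize cu size_scale ?size_polyXn // -size_poly_gt0 size_polyXn.
have cun : zcoef u n = 'X^m by rewrite cu coefZ coefXn eqxx mulr1.
have u0 : u <> 0 by apply/eqP; rewrite -zsize_eq0 su.
by split=> //; rewrite lead_leE su sn /= cun size_polyXn sm !leqnn.
Qed.

Lemma zsize_le1 (b : B) : (zsize b <= 1)%N -> exists p, b = evx p.
Proof.
move=> b1; exists (zcoef b 0); rewrite -evalxz_C -size1_polyC //.
by rewrite -nf_small ?coordK // (leq_trans b1).
Qed.

(** * Locally nilpotent derivations of the surface *)

Section Derivation.
Hypothesis K_char0 : [pchar K] =i pred0.
Variable E : B -> B.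
Hypothesis E_der : derivation E.

Lemma surface_natmul_neq0 n : n.+1%:R != 0 :> B.
Proof.
rewrite -(rmorph_nat constK); apply/eqP/evalx_neq0.
by rewrite polyC_eq0 (iffLR (pcharf0P K) K_char0).
Qed.

(** Derivations are not assumed [K]-linear; a locally nilpotent one kills the
    nonzero constants because they are units. *)
Lemma LND_constK k : locally_nilpotent E -> E (constK k) = 0.
Proof.
move=> E_nil; have [->|k0] := eqVneq k 0; first by rewrite rmorph0 (der0 E_der).
apply: (LND_unit0 (b := constK k^-1) E_der surface_integral) => //.
  exact: surface_natmul_neq0.
by rewrite -(rmorphM constK) divff // rmorph1.
Qed.

Hypothesis E_const : forall k, E (constK k) = 0.

(** A bound on the shift from the value of [g] to that of [E g] propagates from
    the generators to products by the Leibniz rule. It also passes to sums,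
    because every element is a combination of monomials of value at most its
    own; the induction removes the leading monomial. *)
Lemma shift_bound t :
    (forall g, g \in [:: x; y; z] -> lead_le (E g * t) (g * E t)) ->
  forall b, lead_le (E b * t) (b * E t).
Proof.
move=> t_gen.
have le_trans := dom_trans lead_dominance.
have bM a b : lead_le (E a * t) (a * E t) -> lead_le (E b * t) (b * E t) ->
    lead_le (E (a * b) * t) (a * b * E t).
  move=> ha hb; rewrite (derM E_der).
  have -> : (E a * b + a * E b) * t = b * (E a * t) + a * (E b * t) by ring.
  apply: (dom_add lead_dominance).
    have -> : a * b * E t = b * (a * E t) by ring.
    exact: (dom_mull_le lead_dominance).
  by rewrite -mulrA; apply: (dom_mull_le lead_dominance).
have bC k : lead_le (E (constK k) * t) (constK k * E t).
  by rewrite E_const mul0r; apply: (dom_0l lead_dominance).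
have bX g n : g \in [:: x; y; z] -> lead_le (E (g ^+ n) * t) (g ^+ n * E t).
  move=> /t_gen gt; elim: n => [|n IHn]; first by have := bC 1; rewrite rmorph1.
  by rewrite exprS; apply: bM.
suff main N M b : (zsize b < N)%N -> (zweight b < M)%N ->
    lead_le (E b * t) (b * E t).
  by move=> b; apply: (main (zsize b).+1 (zweight b).+1).
elim: N M b => [//|N IHN]; elim=> [//|M IHM] b bN bM'.
have [->|/eqP b0] := eqVneq b 0.
  by rewrite (der0 E_der) !mul0r; apply: (dom_0l lead_dominance).
have [m [i [j /=]]] := lead_monomial b0.
set u := _ * _ => -[u0 bu ub].
have [k] := dom_residue lead_dominance u0 bu; set e := b - _ => eu.
have be : ~~ lead_le b e.
  exact: (dom_lt_le_trans lead_dominance) eu ub.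
have eb : lead_le e b by apply: (dom_ltW lead_dominance).
have bE : b = constK k * u + e by rewrite addrC subrK.
have he : lead_le (E e * t) (e * E t).
  have [eN|eN] := ltnP (zsize e) N; first by apply: (IHN (zweight e).+1).
  by apply: IHM; move: be; rewrite /lead_le; lia.
have hu : lead_le (E u * t) (u * E t).
  by apply: (bM); last apply: (bM); apply: bX; rewrite !inE eqxx ?orbT.
rewrite {1}bE (derD E_der) mulrDl; apply: (dom_add lead_dominance).
  apply: (le_trans _ _ _ (bM _ _ (bC k) hu)).
  apply: (dom_mulr_le lead_dominance).
  by apply: le_trans ub; apply: (dom_const lead_dominance).
by apply: le_trans he _; apply: (dom_mulr_le lead_dominance).
Qed.

Lemma generator_neq0 g : g \in [:: x; y; z] -> g <> 0.
Proof.
move=> gP g0; have : zsize g = 0%N by rewrite g0 zsize0.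
have [hx _] := valuation_x; have [hy _] := valuation_y.
have [hz _] := valuation_z.
by move: gP; rewrite !inE => /or3P[] /eqP->; rewrite ?hx ?hy ?hz.
Qed.

Lemma max_shift_exists : (exists b, E b <> 0) ->
  exists2 t, E t <> 0 & forall b, lead_le (E b * t) (b * E t).
Proof.
move=> [b0 Eb0].
have [t t_in t_gen] := dom_max_shift lead_dominance E generator_neq0.
exists t; last exact: shift_bound.
move=> Et0; apply: Eb0; have Eg0 g : g \in [:: x; y; z] -> E g = 0.
  move=> gP; have := t_gen g gP; rewrite Et0 mulr0.
  move=> /(dom_eq0 lead_dominance)/surface_integral[//|t0].
  by have := generator_neq0 t_in.
have zero_der : derivation (fun _ : B => 0).
  by split=> a b; rewrite ?mul0r ?mulr0 addr0.
by apply: (der_gen_eq E_der zero_der) => [//|||]; apply: Eg0;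
  rewrite !inE eqxx ?orbT.
Qed.

Lemma valuationX (a : B) k : a <> 0 ->
  [/\ a ^+ k <> 0, (zsize (a ^+ k)).-1 = (k * (zsize a).-1)%N
    & zweight (a ^+ k) = (k * zweight a)%N].
Proof.
move=> a0; elim: k => [|k [ak0 sk wk]].
  have one0 : (1 : {poly {poly K}}) != 0 by exact: oner_neq0.
  have [s1 w1] := valuation_ev one0.
  rewrite expr0 -(rmorph1 ev) s1 w1 size_poly1 /weight lead_coef1 !size_poly1.
  rewrite !muln0; split=> //; rewrite rmorph1; move/eqP.
  by rewrite (negPf (surface_natmul_neq0 0)).
have [sa wa] := valuationM a0 ak0.
rewrite exprS sa wa wk mulSn -sk; split=> //.
  exact: (dom_mul_neq0 lead_dominance).
by have := zsize_gt0 a0; have := zsize_gt0 ak0; lia.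
Qed.

Hypotheses (E_nil : locally_nilpotent E) (E_neq0 : exists b, E b <> 0).
Hypotheses (r_gt1 : (1 < r)%N) (d_gt1 : (1 < d)%N).

(** Let [(n', w') - (n, w)] be the shift from the value of [t] to that of [E t],
    with [t] of maximal shift. The weight [psi] of [leading_weight] is a linear
    form in the value by [psiE], and it drops by one along this shift. If
    [n <= n'], then [w' < w] and both [x] and [z] have positive weight, so that
    [E x] and [E z] have the values of [x] and [z] moved by exactly the shift.
    Their first components are consecutive integers; by [zweight_ge], the loss in
    the second component is possible for [z] only if the larger of these integers
    is divisible by [d], and then for [x] only if [r * (d - 1) < d], which fails
    as [r] and [d] are at least two. *)
Lemma LND_zsize (b : B) : E b <> 0 -> (zsize (E b) < zsize b)%N.
Proof.
have [t Et t_max] := max_shift_exists E_neq0.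
have [psi [psiM psi_eqv psi_pos psi_t]] :=
  leading_weight lead_dominance E_der E_nil E_const Et t_max K_char0.
have t0 : t <> 0 by move=> t0; apply: Et; rewrite t0 (der0 E_der).
have zs_mul (u v : B) : u <> 0 -> v <> 0 ->
    (zsize (u * v)).-1 = ((zsize u).-1 + (zsize v).-1)%N.
  move=> u0 v0; have [-> _] := valuationM u0 v0.
  by have := zsize_gt0 u0; have := zsize_gt0 v0; lia.
have wt_mul (u v : B) : u <> 0 -> v <> 0 ->
    zweight (u * v) = (zweight u + zweight v)%N.
  by move=> u0 v0; have [] := valuationM u0 v0.
have psi_eqval u v : u <> 0 -> v <> 0 -> (zsize u).-1 = (zsize v).-1 ->
    zweight u = zweight v -> psi u = psi v.
  move=> u0 v0; have := zsize_gt0 u0; have := zsize_gt0 v0.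
  by move=> ? ? ? ?; apply: psi_eqv => //; rewrite /lead_le; lia.
have psiX u k : u <> 0 -> psi (u ^+ k) = (k * psi u)%N.
  move=> u0; elim: k => [|k IHk].
    have [one0 _ _] := valuationX 0 u0.
    rewrite expr0 in one0 *; have := psiM 1 1 one0 one0; rewrite mulr1.
    by move: (psi 1) => m; lia.
  by have [uk0 _ _] := valuationX k u0; rewrite exprS psiM // IHk mulSn.
have [x0 y0 z0] : [/\ x <> 0, y <> 0 & z <> 0].
  by split; apply: generator_neq0; rewrite !inE eqxx ?orbT.
have [sx wx] := valuation_x; have [sy wy] := valuation_y.
have [sz wz] := valuation_z.
have psiE u : u <> 0 ->
    (d * psi u = (zsize u).-1 * psi y + zweight u * psi x)%N.
  move=> u0; rewrite -!psiX //.
  have [ud0 sud wud] := valuationX d u0.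
  have [yn0 syn wyn] := valuationX (zsize u).-1 y0.
  have [xw0 sxw wxw] := valuationX (zweight u) x0.
  rewrite -psiM //; apply: psi_eqval => //.
  - exact: (dom_mul_neq0 lead_dominance).
  - by rewrite zs_mul // sud syn sxw sy sx /= muln0 addn0 mulnC.
  - by rewrite wt_mul // wud wyn wxw wy wx muln0 mulnC.
have shift_pos u : u <> 0 -> (0 < psi u)%N ->
    [/\ E u <> 0,
        ((zsize t).-1 + (zsize (E u)).-1 = (zsize u).-1 + (zsize (E t)).-1)%N
      & (zweight t + zweight (E u) = zweight u + zweight (E t))%N].
  move=> u0 /(psi_pos u u0)[le1 le2].
  have Eu0 : E u <> 0.
    move=> Eu0; rewrite Eu0 mulr0 in le2.
    by have := dom_eq0 lead_dominance le2; apply: (dom_mul_neq0 lead_dominance).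
  have [sE wE] := lead_le_anti le1 le2.
  by split; rewrite -?zs_mul -?wt_mul // ?sE ?wE.
have decr : ((zsize (E t)).-1 < (zsize t).-1)%N.
  rewrite ltnNge; apply/negP => ts.
  have := psiE t t0; have := psiE (E t) Et; rewrite psi_t => hs ht.
  have : (0 < psi x)%N /\ (zweight (E t) < zweight t)%N.
    by move: hs ht ts; clear -d_gt0; nia.
  move=> [px wts].
  have pz : (0 < psi z)%N.
    by have := psiE z z0; rewrite sz wz /=; move: px r_gt1; clear; nia.
  have [Ex0 sEx wEx] := shift_pos x x0 px.
  have [Ez0 sEz wEz] := shift_pos z z0 pz.
  rewrite sx wx sz wz /= in sEx wEx sEz wEz.
  have gx := zweight_ge (E x); have gz := zweight_ge (E z).
  have nz : (zsize (E z)).-1 = (zsize (E x)).-1.+1 by lia.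
  rewrite nz in gz.
  have wz0 : ((zsize (E x)).-1.+1 %% d = 0)%N.
    have : (r * ((zsize (E x)).-1.+1 %% d) < r * 1)%N by lia.
    by rewrite ltn_mul2l; lia.
  have wx1 : ((zsize (E x)).-1 %% d = d.-1)%N.
    move: wz0; rewrite -addn1 -modnDml.
    have := ltn_pmod (zsize (E x)).-1 d_gt0.
    rewrite leq_eqVlt => /orP[/eqP e _|h]; last by rewrite addn1 modn_small.
    exact: (congr1 predn e).
  rewrite wx1 in gx.
  have : (r * d.-1 < d)%N by lia.
  by move: r_gt1 d_gt1; clear; nia.
move=> Eb; have b0 : b <> 0 by move=> b0; apply: Eb; rewrite b0 (der0 E_der).
have := t_max b; rewrite /lead_le.
have := zs_mul _ _ Eb t0; have := zs_mul _ _ b0 Et.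
have := zsize_gt0 (dom_mul_neq0 lead_dominance Eb t0).
have := zsize_gt0 (dom_mul_neq0 lead_dominance b0 Et).
by have := zsize_gt0 Eb; have := zsize_gt0 b0; lia.
Qed.

Lemma der_ev P : E x = 0 -> E (ev P) = ev P^`() * E z.
Proof.
move=> Ex; have E_evx p : E (evx p) = 0.
  elim/poly_ind: p => [|p c IHp]; first by rewrite rmorph0 (der0 E_der).
  rewrite (rmorphD evx) (rmorphM evx) (derD E_der) (derM E_der) /= IHp evalx_X Ex.
  by rewrite mul0r mulr0 !add0r; apply: E_const.
elim/poly_ind: P => [|P p IHP].
  by rewrite deriv0 rmorph0 (der0 E_der) mul0r.
rewrite derivD derivM derivX derivC mulr1 addr0.
rewrite !(rmorphD ev) !(rmorphM ev) (derD E_der) (derM E_der) /=.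
by rewrite IHP evalxz_C E_evx evalxz_Z addr0 mulrAC mulrDl.
Qed.

(** As [E] lowers the degree in [z], it kills [x] and sends [z] into [K[x]].
    Applying [E] to the relation gives [f(x) * E y = ev phi^`() * E z]; the
    normal form of [E y] has polynomial coefficients, and comparing those of
    [z ^+ d.-1] shows that [f] divides [d%:R * E z]. *)
Lemma LND_shape : exists p,
  [/\ E x = 0, E z = evx p * evx f & E y = evx p * ev phi^`()].
Proof.
have Ex : E x = 0.
  apply: contrapT => Ex0; apply: (Ex0); apply/eqP; rewrite -zsize_eq0.
  by have := LND_zsize Ex0; have [-> _] := valuation_x; rewrite ltnS leqn0.
have [s Ez] : exists s, E z = evx s.
  apply: zsize_le1; have [->|/eqP Ez0] := eqVneq (E z) 0.
    by rewrite zsize0.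
  by have := LND_zsize Ez0; have [-> _] := valuation_z; rewrite ltnS.
have Ey : evx f * E y = evx s * ev phi^`().
  have := der_ev phi Ex; rewrite -surface_relation (derM E_der).
  rewrite -evalxz_C der_ev // derivC rmorph0 !mul0r add0r evalxz_C Ez => ->.
  exact: mulrC.
have phi'_size : (size phi^`() <= d)%N.
  by have := lt_size_deriv (monic_neq0 phi_monic); rewrite phi_deg ltnS.
have fy : f *: coord (E y) = s *: phi^`().
  apply: nf_inj; rewrite nfZ coordK Ey nf_small.
    by rewrite -mul_polyC (rmorphM ev) /= evalxz_C.
  exact: leq_trans (size_scale_leq _ _) phi'_size.
have phi_d : phi`_d = 1.
  by have := monicP phi_monic; rewrite lead_coefE phi_deg.
have d0 : d%:R != 0 :> K.
  by rewrite (iffLR (pcharf0P K) K_char0) -lt0n.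
pose p := (coord (E y))`_d.-1 * d%:R^-1%:P; have sE : s = p * f.
  have := congr1 (fun P => P`_d.-1) fy.
  rewrite /= !coefZ coef_deriv prednK // phi_d => e.
  rewrite /p mulrAC [_ * f]mulrC e -mulrA -polyC_natr -polyCM divff //.
  by rewrite mulr1.
exists p; rewrite Ez sE; split=> //; first exact: (rmorphM evx).
apply/eqP; rewrite -subr_eq0; apply/eqP.
have : evx f * (E y - evx p * ev phi^`()) = 0.
  by rewrite mulrBr Ey sE (rmorphM evx) /= [evx p * _]mulrC -mulrA subrr.
by case/surface_integral => // /(evalx_neq0 f_neq0).
Qed.

End Derivation.

End Valuation.
End NormalForm.
End SurfaceRing.

(* MathComp.  K[x] \ {0} is the set of nonzero elements h = p(x) of the
   surface ring, p ranging over K[X]; as phi lies in K[X][Z], phi^`() is its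
   partial derivative in Z. *)
Theorem corollary8 (K : closedFieldType) (charK0 : [pchar K] =i pred0)
    (f : {poly K}) (r : nat)
    (f_monic : f \is monic) (f_deg : size f = r.+1) (r_gt1 : (1 < r)%N)
    (phi : {poly {poly K}}) (d : nat)
    (phi_monic : phi \is monic) (phi_deg : size phi = d.+1) (d_gt1 : (1 < d)%N)
    (D : surface_ring f phi -> surface_ring f phi)
    (D_der : derivation D) (D_linear : scalable D)
    (Dx : D surface_x = 0)
    (Dy : D surface_y = evalxz (phi^`()))
    (Dz : D surface_z = evalx f) :
  forall E : surface_ring f phi -> surface_ring f phi,
    LND E <->
    exists h : surface_ring f phi,
      [/\ exists p : {poly K}, h = evalx p, h <> 0 &
          forall b, E b = h * D b].
Proof.
have d_gt0 : (0 < d)%N := ltnW d_gt1.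
have Dc k := der_constK k D_der D_linear.
have hD_der h : derivation (fun b => h * D b).
  by split=> a b; rewrite ?(derD D_der) ?(derM D_der); ring.
move=> E; split=> [[E_der E_neq0 E_nil]|[h [[p hp] h0 EhD]]].
  have Ec k :=
    LND_constK f_monic phi_monic phi_deg d_gt0 f_deg charK0 E_der k E_nil.
  have [p [Ex Ez Ey]] := LND_shape f_monic phi_monic phi_deg d_gt0 f_deg charK0
    E_der Ec E_nil E_neq0 r_gt1 d_gt1.
  have EpD : forall b, E b = evalx p * D b.
    apply: (der_gen_eq E_der (hD_der _)) => [k|||].
    - by rewrite Ec Dc mulr0.
    - by rewrite Ex Dx mulr0.
    - by rewrite Ey Dy.
    - by rewrite Ez Dz.
  exists (evalx p); split=> //; first by exists p.
  by move=> p0; case: E_neq0 => b; rewrite EpD p0 mul0r.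
have E_der : derivation E.
  by split=> a b; rewrite !EhD ?(derD D_der) ?(derM D_der); ring.
have D_evx q : D (evalx q) = 0.
  by rewrite -evalxz_C (der_ev D_der Dc _ Dx) derivC rmorph0 mul0r.
split=> //.
  exists surface_z; rewrite EhD Dz.
  move=> /(surface_integral f_monic phi_monic phi_deg d_gt0 f_deg)[//|].
  by apply: (evalx_neq0 f_monic); apply: monic_neq0.
apply: (locally_nilpotent_gen E_der).
- by move=> k; rewrite EhD Dc mulr0.
- by rewrite EhD Dx mulr0.
- by rewrite !EhD Dz hp -(rmorphM (@evalx K f phi)) D_evx mulr0.
- exists (p%:P * phi^`()); rewrite EhD Dy hp (rmorphM (@evalxz K f phi)) /=.
  by rewrite evalxz_C.
Qed.
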